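(* Suppose that $Y$ is a closed convex set, that for every $x\in X$ the functions $f(x,\cdot)$ and $g_i(x,\cdot)$ ($i=1,\dots,l$) are convex on $Y$, that $X$ is convex, that each $g_i$ is convex on $X\times Y$ (jointly in $(x,y)$), and that $f$ is $\rho_f$-weakly convex on $C$. If $\rho_f>0$ and $\gamma\in(0,1/\rho_f)$, then $v_\gamma$ is $\rho_v$-weakly convex on $X\times Y$ with $\rho_v=\dfrac{\rho_f}{1-\gamma\rho_f}$.
   Context: Here $X\subseteq\mathbb{R}^n$, $Y\subseteq\mathbb{R}^m$, $f:X\times Y\to\mathbb{R}$ and $g=(g_1,\dots,g_l):X\times Y\to\mathbb{R}^l$; inequalities between vectors are componentwise. For $x\in X$ put $\mathcal{F}(x)=\{y\in Y: g(x,y)\le 0\}$; $C=\{(x,y)\in X\times Y: y\in\mathcal{F}(x)\}$; $S(x)=\operatorname{argmin}_{y\in\mathcal{F}(x)}f(x,y)$. Standing assumption: $S(x)\neq\emptyset$ for every $x\in X$. For $\gamma>0$, $$v_\gamma(x,y)=\inf_{w\in\mathcal{F}(x)}\Big\{f(x,w)+\frac{1}{2\gamma}\|w-y\|^2\Big\},\qquad (x,y)\in X\times\mathbb{R}^m .$$ A function $\phi$ is $\rho$-weakly convex ($\rho\ge 0$) on a convex set $U$ if $\phi(z)+\frac{\rho}{2}\|z\|^2$ is convex on $U$. *)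

(* Defs.v *)
From mathcomp Require Import all_boot all_order all_algebra.
From mathcomp Require Import all_classical all_reals all_analysis.
Import numFieldNormedType.Exports.

Set Implicit Arguments.
Unset Strict Implicit.
Unset Printing Implicit Defensive.

Import Order.TTheory GRing.Theory Num.Theory.
Local Open Scope classical_set_scope.
Local Open Scope ring_scope.

(* The library norm on 'rV[R]_n is the sup norm (and the norm on a product is
   the max), so the Euclidean squared norms are defined by hand. *)
Definition sqnorm (R : realType) (n : nat) (v : 'rV[R]_n) : R :=
  \sum_(i < n) v ord0 i ^+ 2.

Definition sqnorm2 (R : realType) (n m : nat) (z : 'rV[R]_n * 'rV[R]_m) : R :=
  sqnorm z.1 + sqnorm z.2.

Definition weakly_convex (R : realType) (n m : nat) (rho : R)
    (U : set ('rV[R]_n * 'rV[R]_m)) (phi : 'rV[R]_n * 'rV[R]_m -> R) : Prop :=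
  [/\ 0 <= rho,
      @convex_set R ('rV[R]_n * 'rV[R]_m)%type U &
      @convex_function R ('rV[R]_n * 'rV[R]_m)%type U
        (fun z => phi z + rho / 2 * sqnorm2 z)].

(* In the definitions below, f and g are total functions of which only the
   values on X x Y matter. *)

Definition feasible (R : realType) (n m l : nat) (Y : set 'rV[R]_m)
    (g : 'rV[R]_n * 'rV[R]_m -> 'rV[R]_l) (x : 'rV[R]_n) : set 'rV[R]_m :=
  [set y | Y y /\ forall i : 'I_l, g (x, y) ord0 i <= 0].

Definition feasible_graph (R : realType) (n m l : nat) (X : set 'rV[R]_n)
    (Y : set 'rV[R]_m) (g : 'rV[R]_n * 'rV[R]_m -> 'rV[R]_l) :
    set ('rV[R]_n * 'rV[R]_m) :=
  [set z | (X `*` Y) z /\ feasible Y g z.1 z.2].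

Definition solutions (R : realType) (n m l : nat) (Y : set 'rV[R]_m)
    (f : 'rV[R]_n * 'rV[R]_m -> R) (g : 'rV[R]_n * 'rV[R]_m -> 'rV[R]_l)
    (x : 'rV[R]_n) : set 'rV[R]_m :=
  [set y | feasible Y g x y /\
           forall w, feasible Y g x w -> f (x, y) <= f (x, w)].

(* inf is the real-valued infimum, which takes a default value on sets that are
   empty or unbounded below; this does not occur when solutions Y f g z.1 is
   nonempty and gamma > 0. *)
Definition moreau_value (R : realType) (n m l : nat) (Y : set 'rV[R]_m)
    (f : 'rV[R]_n * 'rV[R]_m -> R) (g : 'rV[R]_n * 'rV[R]_m -> 'rV[R]_l)
    (gamma : R) (z : 'rV[R]_n * 'rV[R]_m) : R :=
  inf [set f (z.1, w) + (2 * gamma)^-1 * sqnorm (w - z.2)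
      | w in feasible Y g z.1].

(* Main.v *)
(** For z1 = (x1, y1), z2 = (x2, y2) and feasible w1, w2, joint convexity of g
    makes the convex combination of w1 and w2 feasible, hence a competitor in
    the infimum defining v_gamma at the combination of z1 and z2.  The defect of
    convexity of the objective at these points is t (1 - t) / 2 times
    [rho (|x1 - x2|^2 + |p|^2) - |p - q|^2 / gamma], with p = w1 - w2 and
    q = y1 - y2, and the infimal convolution bound
    [rho |p|^2 - |p - q|^2 / gamma <= rho / (1 - gamma rho) |q|^2]
    gives the constant. *)
Require Import Defs.
From mathcomp Require Import all_boot all_order all_algebra.
From mathcomp Require Import all_classical all_reals all_analysis.
From mathcomp Require Import ring lra.
Import numFieldNormedType.Exports.

Set Implicit Arguments.
Unset Strict Implicit.
Unset Printing Implicit Defensive.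

Import Order.TTheory GRing.Theory Num.Theory.
Local Open Scope classical_set_scope.
Local Open Scope ring_scope.

Lemma sqnorm_ge0 (R : realType) (n : nat) (v : 'rV[R]_n) : 0 <= sqnorm v.
Proof. by apply: sumr_ge0 => i _; exact: sqr_ge0. Qed.

(** An exact identity rather than an inequality: it turns every weak convexity bound into one with
    an explicit quadratic defect. *)
Lemma sqnorm_conv (R : realType) (n : nat) (t : R) (u v : 'rV[R]_n) :
  sqnorm (t *: u + (1 - t) *: v) =
  t * sqnorm u + (1 - t) * sqnorm v - t * (1 - t) * sqnorm (u - v).
Proof.
rewrite /sqnorm !mulr_sumr -big_split -sumrB /=.
by apply: eq_bigr => i _; rewrite !mxE; ring.
Qed.

(** Coordinate by coordinate, right side minus left side is a perfect square over
    [gamma * (1 - gamma * rho) > 0]. Equality holds at [q = (1 - gamma * rho) *: p]. *)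
Lemma sqnorm_infconv (R : realType) (n : nat) (rho gamma : R)
    (p q : 'rV[R]_n) :
  0 < gamma -> gamma * rho < 1 ->
  rho * sqnorm p - gamma^-1 * sqnorm (p - q) <=
  rho / (1 - gamma * rho) * sqnorm q.
Proof.
move=> gamma_gt0 lt1; have c_gt0 : 0 < 1 - gamma * rho by rewrite subr_gt0.
rewrite /sqnorm !mulr_sumr -sumrB; apply: ler_sum => i _; rewrite !mxE.
rewrite -subr_ge0.
set a := p _ _; set b := q _ _.
have -> : rho / (1 - gamma * rho) * b ^+ 2 -
    (rho * a ^+ 2 - gamma^-1 * (a - b) ^+ 2) =
    ((1 - gamma * rho) * a - b) ^+ 2 / (gamma * (1 - gamma * rho)).
  by field; rewrite !gt_eqF.
by rewrite divr_ge0 ?sqr_ge0// mulr_ge0// ltW.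
Qed.

(** The infima need not be attained: points within [e] of each one give the bound up to
    [t * e + (1 - t) * e = e], for every [e > 0]. *)
Lemma le_conv_inf (R : realType) (A B : set R) (t c : R) :
  has_inf A -> has_inf B -> 0 <= t <= 1 ->
  (forall a b, A a -> B b -> c <= t * a + (1 - t) * b) ->
  c <= t * inf A + (1 - t) * inf B.
Proof.
move=> infA infB /andP[t0 t1] cAB; apply/ler_addgt0Pr => e e0.
have [a Aa lta] := inf_adherent e0 infA.
have [b Bb ltb] := inf_adherent e0 infB.
apply: (le_trans (cAB _ _ Aa Bb)).
have : t * a <= t * (inf A + e) by rewrite ler_wpM2l// ltW.
have : (1 - t) * b <= (1 - t) * (inf B + e).
  by rewrite ler_wpM2l ?subr_ge0// ltW.
lra.
Qed.

Lemma weakly_convex_le (R : realType) (n m : nat) (rho : R)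
    (U : set ('rV[R]_n * 'rV[R]_m)) (phi : 'rV[R]_n * 'rV[R]_m -> R) (t : R)
    (z1 z2 : 'rV[R]_n * 'rV[R]_m) :
  weakly_convex rho U phi -> 0 <= t <= 1 -> U z1 -> U z2 ->
  phi (t *: z1 + (1 - t) *: z2) <=
  t * phi z1 + (1 - t) * phi z2 +
  rho / 2 * (t * (1 - t)) * sqnorm2 (z1 - z2).
Proof.
move=> [_ _ cvx] /andP[t0 t1] /mem_set Uz1 /mem_set Uz2.
have := cvx (Itv01 t0 t1) z1 z2 Uz1 Uz2.
(* Up to conversion, this replaces the abstract convex combinations by scalings and sums, on which
   [sqnorm_conv] and [lra] can act. *)
rewrite -[_ <= _]/(phi (t *: z1 + (1 - t) *: z2) +
    rho / 2 * sqnorm2 (t *: z1 + (1 - t) *: z2) <=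
  t * (phi z1 + rho / 2 * sqnorm2 z1) +
  (1 - t) * (phi z2 + rho / 2 * sqnorm2 z2)).
by rewrite /sqnorm2 /= !sqnorm_conv; lra.
Qed.

Lemma weakly_convex_of_le (R : realType) (n m : nat) (rho : R)
    (U : set ('rV[R]_n * 'rV[R]_m)) (phi : 'rV[R]_n * 'rV[R]_m -> R) :
  0 <= rho -> @convex_set R ('rV[R]_n * 'rV[R]_m)%type U ->
  (forall (t : R) z1 z2, 0 <= t <= 1 -> U z1 -> U z2 ->
    phi (t *: z1 + (1 - t) *: z2) <=
    t * phi z1 + (1 - t) * phi z2 +
    rho / 2 * (t * (1 - t)) * sqnorm2 (z1 - z2)) ->
  weakly_convex rho U phi.
Proof.
move=> rho0 cvxU le_phi; split=> // t z1 z2 /set_mem Uz1 /set_mem Uz2.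
have t01 : 0 <= t%:num <= 1 by rewrite ge0 le1.
change (phi (t%:num *: z1 + (1 - t%:num) *: z2) +
    rho / 2 * sqnorm2 (t%:num *: z1 + (1 - t%:num) *: z2) <=
  t%:num * (phi z1 + rho / 2 * sqnorm2 z1) +
  (1 - t%:num) * (phi z2 + rho / 2 * sqnorm2 z2)).
have := le_phi _ _ _ t01 Uz1 Uz2.
by rewrite /sqnorm2 /= !sqnorm_conv; lra.
Qed.

Lemma convex_setX (R : realType) (V W : lmodType R) (A : set V) (B : set W) :
  @convex_set R V A -> @convex_set R W B ->
  @convex_set R (V * W)%type (A `*` B).
Proof.
move=> cvxA cvxB [a b] [a' b'] t /set_mem[/= Aa Bb] /set_mem[/= Aa' Bb'].
apply/mem_set; split => /=; apply: set_mem.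
  by apply: (cvxA a a' t); apply/mem_set.
by apply: (cvxB b b' t); apply/mem_set.
Qed.

Lemma convex_setP (R : realType) (V : lmodType R) (A : set V) (t : R) (a b : V) :
  @convex_set R V A -> 0 <= t <= 1 -> A a -> A b -> A (t *: a + (1 - t) *: b).
Proof.
move=> cvxA /andP[t0 t1] /mem_set Aa /mem_set Ab; apply: set_mem.
exact: (cvxA a b (Itv01 t0 t1)).
Qed.

Lemma feasible_conv (R : realType) (n m l : nat) (X : set 'rV[R]_n)
    (Y : set 'rV[R]_m) (g : 'rV[R]_n * 'rV[R]_m -> 'rV[R]_l) (t : R)
    (x1 x2 : 'rV[R]_n) (w1 w2 : 'rV[R]_m) :
  @convex_set R 'rV[R]_m Y ->
  (forall i : 'I_l, @convex_function R ('rV[R]_n * 'rV[R]_m)%type (X `*` Y)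
     (fun z => g z ord0 i)) ->
  0 <= t <= 1 -> X x1 -> X x2 -> feasible Y g x1 w1 -> feasible Y g x2 w2 ->
  feasible Y g (t *: x1 + (1 - t) *: x2) (t *: w1 + (1 - t) *: w2).
Proof.
move=> cvxY cvxg t01 Xx1 Xx2 [Yw1 g1] [Yw2 g2].
split=> [|i]; first exact: convex_setP.
have /andP[t0 t1] := t01.
have z1 : (x1, w1) \in X `*` Y by apply/mem_set.
have z2 : (x2, w2) \in X `*` Y by apply/mem_set.
apply: le_trans (cvxg i (Itv01 t0 t1) (x1, w1) (x2, w2) z1 z2) _.
change (t * g (x1, w1) ord0 i + (1 - t) * g (x2, w2) ord0 i <= 0).
by rewrite -oppr_ge0 opprD addr_ge0// -mulrN mulr_ge0 ?oppr_ge0 ?subr_ge0.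
Qed.

(** The penalty is nonnegative, so the minimal value of [f (z.1, _)] is a lower bound. Hence [inf]
    is a true infimum here, not its default value. *)
Lemma moreau_has_inf (R : realType) (n m l : nat) (Y : set 'rV[R]_m)
    (f : 'rV[R]_n * 'rV[R]_m -> R) (g : 'rV[R]_n * 'rV[R]_m -> 'rV[R]_l)
    (gamma : R) (z : 'rV[R]_n * 'rV[R]_m) :
  0 <= gamma -> solutions Y f g z.1 !=set0 ->
  has_inf [set f (z.1, w) + (2 * gamma)^-1 * sqnorm (w - z.2)
          | w in feasible Y g z.1].
Proof.
move=> gamma0 [y [Fy miny]]; split; first by eexists; exists y.
exists (f (z.1, y)) => _ [w Fw <-].
by rewrite (le_trans (miny w Fw))// lerDl mulr_ge0 ?sqnorm_ge0// invr_ge0 mulr_ge0.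
Qed.

Theorem theorem2 (R : realType) (n m l : nat)
    (X : set 'rV[R]_n) (Y : set 'rV[R]_m)
    (f : 'rV[R]_n * 'rV[R]_m -> R) (g : 'rV[R]_n * 'rV[R]_m -> 'rV[R]_l)
    (rho_f gamma : R)
    (hS : forall x, X x -> solutions Y f g x !=set0)
    (hYclosed : closed Y)
    (hYconvex : @convex_set R 'rV[R]_m Y)
    (hfx : forall x, X x -> @convex_function R 'rV[R]_m Y (fun y => f (x, y)))
    (hgx : forall x, X x -> forall i : 'I_l,
      @convex_function R 'rV[R]_m Y (fun y => g (x, y) ord0 i))
    (hX : @convex_set R 'rV[R]_n X)
    (hg : forall i : 'I_l,
      @convex_function R ('rV[R]_n * 'rV[R]_m)%type (X `*` Y)
        (fun z => g z ord0 i))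
    (hf : weakly_convex rho_f (feasible_graph X Y g) f)
    (hrho : 0 < rho_f)
    (hgamma : 0 < gamma /\ gamma < 1 / rho_f) :
  weakly_convex (rho_f / (1 - gamma * rho_f)) (X `*` Y)
    (moreau_value Y f g gamma).
Proof.
case: hgamma => gamma_gt0; rewrite ltr_pdivlMr// => lt1.
have c_gt0 : 0 < 1 - gamma * rho_f by rewrite subr_gt0.
(* The penalty involves only the second variable, so the [x] part keeps the constant [rho_f], which
   this bound absorbs into the larger one. *)
have rho_le : rho_f <= rho_f / (1 - gamma * rho_f).
  by rewrite ler_pdivlMr// ler_piMr ?ltW// ltrBlDr ltrDl mulr_gt0.
apply: weakly_convex_of_le; [|exact: convex_setX|].
  by apply: le_trans rho_le; exact: ltW.
move=> t [x1 y1] [x2 y2] t01 [/= Xx1 _] [/= Xx2 _].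
have Xx : X (t *: x1 + (1 - t) *: x2) by exact: convex_setP.
(* With the defect moved to the left, the right side is a combination of two infima, and arbitrary
   feasible [w1], [w2] can be tested. *)
rewrite -lerBlDr; apply: le_conv_inf => //.
- by apply: moreau_has_inf; [exact: ltW | exact: hS].
- by apply: moreau_has_inf; [exact: ltW | exact: hS].
move=> _ _ [w1 /= Fw1 <-] [w2 /= Fw2 <-]; rewrite lerBlDr.
have Fw := feasible_conv hYconvex hg t01 Xx1 Xx2 Fw1 Fw2.
have [_ lbd] := moreau_has_inf (z := t *: (x1, y1) + (1 - t) *: (x2, y2))
  (ltW gamma_gt0) (hS _ Xx).
apply: le_trans (ge_inf lbd (ex_intro2 _ _ _ Fw erefl)) _ => /=.
have := weakly_convex_le (z1 := (x1, w1)) (z2 := (x2, w2)) hf t01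
  (conj (conj Xx1 Fw1.1) Fw1) (conj (conj Xx2 Fw2.1) Fw2).
have -> : t *: (x1, w1) + (1 - t) *: (x2, w2) =
    (t *: x1 + (1 - t) *: x2, t *: w1 + (1 - t) *: w2) by [].
rewrite /sqnorm2 /=.
(* Regrouped this way, the penalty is taken at a convex combination, and [sqnorm_conv] yields the
   negative term that [sqnorm_infconv] uses. *)
have -> : t *: w1 + (1 - t) *: w2 - (t *: y1 + (1 - t) *: y2) =
    t *: (w1 - y1) + (1 - t) *: (w2 - y2).
  by rewrite !scalerBr opprD addrACA.
rewrite sqnorm_conv.
have -> : w1 - y1 - (w2 - y2) = w1 - w2 - (y1 - y2).
  by rewrite !opprD !opprK addrACA.
have le_q := sqnorm_infconv (w1 - w2) (y1 - y2) gamma_gt0 lt1.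
have le_x := ler_wpM2r (sqnorm_ge0 (x1 - x2)) rho_le.
have tt0 : 0 <= t * (1 - t) / 2.
  by case/andP: t01 => t0 t1; rewrite divr_ge0 ?mulr_ge0 ?subr_ge0.
have := ler_wpM2l tt0 (lerD le_x le_q).
(* Splitting [(2 * gamma)^-1] leaves [gamma^-1] as a common atom, matching the penalty terms with
   those of [le_q]. *)
rewrite invfM.
lra.
Qed.
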